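(* For every natural number $n\geq 1$, $$p_n\leq \frac{n^{3}(n^{2}+1)(7n^{2}+5)}{24}.$$
   Context: For a real square matrix $B$, $s(B)$ denotes the sum of all entries of $B$. For a natural number $n\geq 1$, $p_n$ denotes the maximum of $s(A^2)$ over all $n\times n$ matrices $A$ whose entries are the numbers $1,2,\ldots,n^2$, each appearing exactly once. Here $A^2$ is the usual matrix product $A\cdot A$. *)

(* Defs.v *)
From mathcomp Require Import all_boot all_order all_algebra.
Set Implicit Arguments.
Unset Strict Implicit.
Unset Printing Implicit Defensive.
Import Order.TTheory GRing.Theory Num.Theory.

Definition entry_sum (R : nmodType) (n : nat) (B : 'M[R]_n) : R :=
  (\sum_(i < n) \sum_(j < n) B i j)%R.

(* The multiset of entries of A is {1, 2, ..., n^2}, without repetition. *)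
Definition is_filling (n : nat) (A : 'M[nat]_n) : bool :=
  perm_eq [seq A ij.1 ij.2 | ij : 'I_n * 'I_n] (iota 1 (n ^ 2)).

(* Matrices of ordinals are used only to have a finite index type for the
   maximum; [max_square_sum_ub] and [max_square_sum_attained] show that this is
   the maximum over all fillings A : 'M[nat]_n. *)
Definition max_square_sum (n : nat) : nat :=
  \max_(A : 'M['I_(n ^ 2).+1]_n | is_filling (map_mx val A))
    entry_sum (map_mx val A *m map_mx val A)%R.

Lemma filling_lift (n : nat) (A : 'M[nat]_n) :
  is_filling A -> exists B : 'M['I_(n ^ 2).+1]_n, map_mx val B = A.
Proof.
move=> fA; exists (map_mx inord A); apply/matrixP=> i j; rewrite !mxE /= inordK //.
have : A i j \in iota 1 (n ^ 2).
  by rewrite -(perm_mem fA); apply/mapP; exists (i, j); rewrite ?mem_enum.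
by rewrite mem_iota add1n => /andP[].
Qed.

Lemma max_square_sum_ub (n : nat) (A : 'M[nat]_n) :
  is_filling A -> entry_sum (A *m A)%R <= max_square_sum n.
Proof.
move=> fA; have [B eBA] := filling_lift fA; rewrite -eBA in fA *.
exact: (leq_bigmax_cond (F := fun B : 'M['I_(n ^ 2).+1]_n =>
  entry_sum (map_mx val B *m map_mx val B)%R)).
Qed.

Lemma filling_exists (n : nat) : exists A : 'M[nat]_n, is_filling A.
Proof.
exists (\matrix_(i, j) (enum_rank (i, j)).+1)%R.
have cardE : #|{: 'I_n * 'I_n}| = n ^ 2 by rewrite card_prod card_ord.
apply: uniq_perm; first by rewrite map_inj_uniq ?enum_uniq // => -[i j] [k l];
  rewrite !mxE => -[] /val_inj /enum_rank_inj.
  exact: iota_uniq.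
move=> k; rewrite mem_iota add1n ltnS -cardE; apply/mapP/andP.
  by case=> -[i j] _ ->; rewrite mxE; split=> //; apply: ltn_ord.
case: k => [[]//|k] [_ ltk]; exists (enum_val (Ordinal ltk)); rewrite ?mem_enum //.
by rewrite mxE -surjective_pairing enum_valK.
Qed.

Lemma max_square_sum_attained (n : nat) :
  exists2 A : 'M[nat]_n, is_filling A & max_square_sum n = entry_sum (A *m A)%R.
Proof.
have [A fA] := filling_exists n; have [B eBA] := filling_lift fA.
rewrite -eBA in fA.
rewrite /max_square_sum (bigop.bigmax_eq_arg _ fA).
by case: arg_maxnP => // C fC _; exists (map_mx val C).
Qed.

(* Main.v *)
Require Import Defs.
From mathcomp Require Import all_boot all_order all_algebra.
From mathcomp Require Import ring lra.
Import Order.TTheory GRing.Theory Num.Theory.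
Local Open Scope ring_scope.

(** Write [r_k] and [c_k] for the sum of row [k] and of column [k] of [A].
    The entry sum of [A^2] counts the walks [i -> k -> j], so it is
    [\sum_k c_k * r_k], which is at most half of [\sum_k r_k^2 + \sum_k c_k^2].

    In the Euclidean space of matrices, [\sum_k r_k^2 / n] and
    [\sum_k c_k^2 / n] are the squared norms of the projections of [A] onto the
    matrices with constant rows and onto those with constant columns.  These
    subspaces are orthogonal up to their intersection, the constant matrices,
    where the projection of [A] has squared norm [S^2 / n^2], with [S] the sum
    of all entries.  Bessel's inequality ([row_col_sum_Bessel]) therefore gives
    [\sum_k r_k^2 + \sum_k c_k^2 <= n * \sum_(i, j) A_ij^2 + S^2 / n].

    The right-hand side depends only on the multiset of entries.  When this is
    [{1, ..., n^2}], the sum of the entries is [n^2(n^2+1)/2], that of their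
    squares is [n^2(n^2+1)(2n^2+1)/6], and half of the bound is exactly
    [n^3(n^2+1)(7n^2+5)/24]. *)

Lemma entry_sum_sqr (R : comPzSemiRingType) (n : nat) (A : 'M[R]_n) :
  entry_sum (A *m A) = \sum_k (\sum_i A i k) * (\sum_j A k j).
Proof.
under eq_bigr => k _ do rewrite big_distrlr /=.
rewrite exchange_big; apply: eq_bigr => i _ /=.
by rewrite exchange_big; apply: eq_bigr => j _; rewrite mxE.
Qed.

(** The squared distance from [A] to the matrix [u_i + v_j], a general element
    of the span of the matrices with constant rows and those with constant
    columns. *)
Lemma sum_sqr_sub_row_col (R : comPzRingType) (n : nat) (A : 'M[R]_n)
    (u v : 'I_n -> R) :
  \sum_i \sum_j (A i j - u i - v j) ^+ 2 =
    \sum_i \sum_j A i j ^+ 2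
    - 2 * (\sum_i u i * \sum_j A i j) - 2 * (\sum_j v j * \sum_i A i j)
    + n%:R * (\sum_i u i ^+ 2) + n%:R * (\sum_j v j ^+ 2)
    + 2 * ((\sum_i u i) * (\sum_j v j)).
Proof.
have -> : \sum_j v j * (\sum_i A i j) = \sum_i \sum_j v j * A i j.
  by rewrite exchange_big; apply: eq_bigr => j _; rewrite mulr_sumr.
rewrite [(\sum_i u i) * _]mulr_suml.
have -> : n%:R * (\sum_j v j ^+ 2) = \sum_(i < n) \sum_j v j ^+ 2.
  by rewrite sumr_const card_ord mulr_natl.
rewrite !mulr_sumr -!sumrN -!big_split; apply: eq_bigr => i _ /=.
have -> : n%:R * u i ^+ 2 = \sum_(j < n) u i ^+ 2.
  by rewrite sumr_const card_ord mulr_natl.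
rewrite !mulr_sumr -!sumrN -!big_split; apply: eq_bigr => j _ /=.
ring.
Qed.

(** The squared distance from [A] to its orthogonal projection onto the span of
    the matrices with constant rows and those with constant columns is
    nonnegative; multiplied by [n], this is the inequality. *)
Lemma row_col_sum_Bessel (R : realFieldType) (n : nat) (A : 'M[R]_n) :
  (0 < n)%N ->
  \sum_i (\sum_j A i j) ^+ 2 + \sum_j (\sum_i A i j) ^+ 2
    <= n%:R * (\sum_i \sum_j A i j ^+ 2) + entry_sum A ^+ 2 / n%:R.
Proof.
move=> n_gt0; set S := entry_sum A; set x : R := n%:R.
have x_gt0 : 0 < x by rewrite ltr0n.
have x_neq0 : x != 0 by rewrite gt_eqF.
set r := fun i => \sum_j A i j; set c := fun j => \sum_i A i j.
have sum_r : \sum_i r i = S by [].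
have sum_c : \sum_j c j = S by rewrite /c exchange_big.
have sum_const (a : R) : \sum_(j < n) a = x * a.
  by rewrite sumr_const card_ord mulr_natl.
have dist_sqr_ge0 u v : 0 <= \sum_i \sum_j A i j ^+ 2
    - 2 * (\sum_i u i * r i) - 2 * (\sum_j v j * c j)
    + x * (\sum_i u i ^+ 2) + x * (\sum_j v j ^+ 2)
    + 2 * ((\sum_i u i) * (\sum_j v j)).
  rewrite -sum_sqr_sub_row_col.
  by apply: sumr_ge0 => i _; apply: sumr_ge0 => j _; apply: sqr_ge0.
rewrite -[X in X + _ <= _]/(\sum_i r i ^+ 2).
rewrite -[X in _ + X <= _]/(\sum_j c j ^+ 2).
(* The sums over [i] and [j] inside [r], [c] and [S] must not be touched by the
   bigop rewriting below, which only concerns the outer sums. *)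
clearbody r c S.
(* [u i + v j] is the orthogonal projection of [A]; the constant part [S / n^2],
   common to both families, is subtracted once, in [v]. *)
pose u i := r i / x; pose v j := c j / x - S / x ^+ 2.
have sum_u : \sum_i u i = S / x by rewrite -mulr_suml sum_r.
have sum_v : \sum_j v j = 0.
  by rewrite sumrB -mulr_suml sum_c sum_const; field.
have sum_ur : \sum_i u i * r i = (\sum_i r i ^+ 2) / x.
  by rewrite mulr_suml; apply: eq_bigr => i _; rewrite /u; ring.
have sum_u2 : \sum_i u i ^+ 2 = (\sum_i r i ^+ 2) / x ^+ 2.
  by rewrite mulr_suml; apply: eq_bigr => i _; rewrite /u; field.
have sum_vc : \sum_j v j * c j = (\sum_j c j ^+ 2) / x - S ^+ 2 / x ^+ 2.
  have -> : \sum_j v j * c j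
      = (\sum_j c j ^+ 2) / x - (\sum_j c j) * (S / x ^+ 2).
    by rewrite !mulr_suml -sumrB; apply: eq_bigr => j _; rewrite /v; ring.
  by rewrite sum_c; ring.
have sum_v2 : \sum_j v j ^+ 2 = (\sum_j c j ^+ 2) / x ^+ 2 - S ^+ 2 / x ^+ 3.
  have -> : \sum_j v j ^+ 2
      = (\sum_j v j * c j) / x - (\sum_j v j) * (S / x ^+ 2).
    by rewrite !mulr_suml -sumrB; apply: eq_bigr => j _; rewrite expr2 {2}/v; ring.
  by rewrite sum_vc sum_v; field.
have := dist_sqr_ge0 u v; rewrite sum_ur sum_vc sum_u2 sum_v2 sum_u sum_v.
move=> /(mulr_ge0 (ltW x_gt0)); rewrite -[X in _ -> is_true X]subr_ge0.
congr (is_true (0 <= _)).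
by field.
Qed.

Lemma entry_sum_sqr_le (R : realFieldType) (n : nat) (A : 'M[R]_n) :
  (0 < n)%N ->
  entry_sum (A *m A)
    <= (n%:R * (\sum_i \sum_j A i j ^+ 2) + entry_sum A ^+ 2 / n%:R) / 2.
Proof.
move=> n_gt0; rewrite ler_pdivlMr // entry_sum_sqr.
apply: le_trans (row_col_sum_Bessel _ _ A n_gt0).
rewrite mulr_suml -big_split; apply: ler_sum => k _ /=.
set r := \sum_j A k j; set c := \sum_i A i k.
by have := sqr_ge0 (r - c); rewrite sqrrB -mulr_natr; lra.
Qed.

Lemma sum_filling (R : nmodType) (n : nat) (A : 'M[nat]_n) (f : nat -> R) :
  is_filling A -> \sum_i \sum_j f (A i j) = \sum_(k <- iota 1 (n ^ 2)) f k.
Proof.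
by move=> fA; rewrite -(perm_big _ fA) big_image pair_big.
Qed.

Lemma sum_iota (R : numFieldType) (m : nat) :
  \sum_(k <- iota 1 m) k%:R = m%:R * (m%:R + 1) / 2 :> R.
Proof.
elim: m => [|m IHm]; first by rewrite big_nil !mul0r.
by rewrite -{1}(addn1 m) iotaD big_cat big_seq1 IHm add1n /= -[m.+1%:R]natr1; field.
Qed.

Lemma sum_iota_sqr (R : numFieldType) (m : nat) :
  \sum_(k <- iota 1 m) k%:R ^+ 2
    = m%:R * (m%:R + 1) * (2 * m%:R + 1) / 6 :> R.
Proof.
elim: m => [|m IHm]; first by rewrite big_nil !mul0r.
by rewrite -{1}(addn1 m) iotaD big_cat big_seq1 IHm add1n /= -[m.+1%:R]natr1; field.
Qed.

Theorem corollary4 (n : nat) (hn : (1 <= n)%N) :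
  (max_square_sum n)%:R <=
    n%:R ^+ 3 * (n%:R ^+ 2 + 1) * (7 * n%:R ^+ 2 + 5) / 24 :> rat.
Proof.
have [A fA ->] := max_square_sum_attained n.
pose B : 'M[rat]_n := map_mx (fun k => k%:R) A.
have -> : (entry_sum (A *m A))%:R = entry_sum (B *m B).
  rewrite !entry_sum_sqr natr_sum; apply: eq_bigr => k _.
  by rewrite natrM !natr_sum; congr (_ * _); apply: eq_bigr => i _; rewrite mxE.
apply: le_trans (entry_sum_sqr_le _ _ B hn) _.
have -> : entry_sum B = n%:R ^+ 2 * (n%:R ^+ 2 + 1) / 2.
  rewrite -natrX -sum_iota -(sum_filling _ _ _ _ fA).
  by apply: eq_bigr => i _; apply: eq_bigr => j _; rewrite mxE.
have -> : \sum_i \sum_j B i j ^+ 2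
    = n%:R ^+ 2 * (n%:R ^+ 2 + 1) * (2 * n%:R ^+ 2 + 1) / 6.
  rewrite -natrX -sum_iota_sqr -(sum_filling _ _ _ (fun k => k%:R ^+ 2) fA).
  by apply: eq_bigr => i _; apply: eq_bigr => j _; rewrite mxE.
have n_neq0 : n%:R != 0 :> rat by rewrite pnatr_eq0 -lt0n.
by rewrite le_eqVlt; apply/orP; left; apply/eqP; field.
Qed.
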